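(* Let $\kappa$ be a cardinal with $\aleph_0\leq\kappa<2^{\aleph_0}$. Each of the statements (5), (6), (7) below is equivalent to each of the statements (1)–(4) below; that is, all of the following seven statements are equivalent. (1) $MA(\kappa)$: for each non-empty compact space $X$ with the ccc, if $(U_\alpha:\alpha<\kappa)$ is a family of open dense subsets of $X$, then $\bigcap\{U_\alpha:\alpha<\kappa\}\neq\emptyset$. (2) For each space $X$ with the ccc such that $\{x\in X: x \text{ has a compact neighborhood}\}$ is dense in $X$, if $(U_\alpha:\alpha<\kappa)$ is a family of open dense subsets of $X$, then $\bigcap\{U_\alpha:\alpha<\kappa\}$ is a dense subset of $X$. (3) For each poset $(\mathbb{P},\leq,1)$ with the ccc, if $\mathcal{D}$ is a family of dense subsets of $\mathbb{P}$ with $|\mathcal{D}|\leq\kappa$, then there exists a filter $G\subseteq\mathbb{P}$ such that $D\cap G\neq\emptyset$ for every $D\in\mathcal{D}$. (4) For each non-empty quasiregular H-closed space $X$ with the ccc, if $(U_\alpha:\alpha<\kappa)$ is a family of open dense subsets of $X$, then $\bigcap\{U_\alpha:\alpha<\kappa\}\neq\emptyset$. (5) For each space $X$ with the ccc such that $\{x\in X: x \text{ has a quasiregular H-closed neighborhood}\}$ is dense in $X$, if $(U_\alpha:\alpha<\kappa)$ is a family of open dense subsets of $X$, then $\bigcap\{U_\alpha:\alpha<\kappa\}$ is a dense subset of $X$. (6) For each space $X$ with the ccc and a compact $\pi$-base, if $(U_\alpha:\alpha<\kappa)$ is a family of open dense subsets of $X$, then $\bigcap\{U_\alpha:\alpha<\kappa\}$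 is dense in $X$. (7) For each space $X$ with the ccc and a quasiregular H-closed $\pi$-base, if $(U_\alpha:\alpha<\kappa)$ is a family of open dense subsets of $X$, then $\bigcap\{U_\alpha:\alpha<\kappa\}$ is dense in $X$.
   Context: All spaces are Hausdorff topological spaces. A space $X$ is quasiregular if for every non-empty open set $U\subseteq X$ there is a non-empty open set $V\subseteq X$ with $\overline{V}\subseteq U$. A space $X$ is H-closed if it is Hausdorff and closed in every Hausdorff space in which it is embedded; equivalently, $X$ is Hausdorff and every open cover $\mathcal{U}$ of $X$ has a finite subfamily $\mathcal{V}\subseteq\mathcal{U}$ with $\overline{\bigcup\mathcal{V}}=X$. A space has the ccc if every family of pairwise disjoint non-empty open subsets is countable. A $\pi$-base of $X$ is a family $\mathcal{B}$ of non-empty open subsets of $X$ such that every non-empty open subset of $X$ contains a member of $\mathcal{B}$. A compact (respectively, quasiregular H-closed) $\pi$-base is a $\pi$-base $\mathcal{B}$ such that for every $B\in\mathcal{B}$ the closure $\overline{B}$, as a subspace, is compact (respectively, both quasiregular and H-closed). A poset $(\mathbb{P},\leq,1)$ has a maximum element $1$. A subset $D\subseteq\mathbb{P}$ is dense if for every $p\in\mathbb{P}$ there is $d\in D$ with $d\leq p$. Elements $p,q\in\mathbb{P}$ are compatible if there is $r\in\mathbb{P}$ with $r\leq p$ and $r\leq q$, and incompatible otherwise. The poset has the ccc if every antichain (subset whose elements are pairwise incompatible) is countable. A subset $G\subseteq\mathbb{P}$ is a filter if (a) $1\in G$; (b) for every $p,q\in G$ there is $r\in G$ with $r\leq p$ and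 $r\leq q$; (c) for all $p,q\in\mathbb{P}$, if $p\in G$ and $p\leq q$, then $q\in G$. *)

(* Defs.v *)
From mathcomp Require Import all_boot all_order.
From mathcomp Require Import all_classical topology.

Set Implicit Arguments.
Unset Strict Implicit.
Unset Printing Implicit Defensive.

Local Open Scope classical_set_scope.

(* A set A : set X used as a type is [set_type A], which the library equips
   with the subspace topology (the initial topology of the inclusion).  It is
   not [subspace A], whose carrier is all of X. *)

Definition quasiregular (X : topologicalType) : Prop :=
  forall U : set X, open U -> U !=set0 ->
    exists V : set X, [/\ open V, V !=set0 & closure V `<=` U].

Definition embedding (X Y : topologicalType) (f : X -> Y) : Prop :=
  [/\ injective f, continuous f &
      forall U : set X, open U ->
        exists2 V : set Y, open V & f @` U = V `&` range f].

Definition H_closed (X : topologicalType) : Prop :=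
  hausdorff_space X /\
  forall (Y : topologicalType) (f : X -> Y),
    hausdorff_space Y -> embedding f -> closed (range f).

Definition ccc_space (X : topologicalType) : Prop :=
  forall F : set (set X),
    (forall U, F U -> open U /\ U !=set0) -> trivIset F id -> countable F.

Definition pi_base (X : topologicalType) (B : set (set X)) : Prop :=
  (forall U, B U -> open U /\ U !=set0) /\
  (forall O : set X, open O -> O !=set0 -> exists2 U, B U & U `<=` O).

Definition compact_pi_base (X : topologicalType) (B : set (set X)) : Prop :=
  pi_base B /\ forall U, B U -> compact (closure U).

Definition qHc_pi_base (X : topologicalType) (B : set (set X)) : Prop :=
  pi_base B /\
  forall U, B U -> quasiregular (closure U) /\ H_closed (closure U).

Definition has_compact_nbhs (X : topologicalType) (x : X) : Prop :=
  exists2 N : set X, nbhs x N & compact N.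

Definition has_qHc_nbhs (X : topologicalType) (x : X) : Prop :=
  exists2 N : set X, nbhs x N & quasiregular N /\ H_closed N.

Section Posets.
Context {d : Order.disp_t} {P : tPOrderType d}.
Local Open Scope order_scope.

Definition poset_dense (D : set P) : Prop :=
  forall p, exists2 q, D q & q <= p.

Definition compatible (p q : P) : Prop := exists r, r <= p /\ r <= q.

Definition antichain (A : set P) : Prop :=
  forall p q, A p -> A q -> p <> q -> ~ compatible p q.

Definition poset_filter (G : set P) : Prop :=
  [/\ G \top,
      forall p q, G p -> G q -> exists r, [/\ G r, r <= p & r <= q] &
      forall p q, G p -> p <= q -> G q].

End Posets.

Definition ccc_poset (d : Order.disp_t) (P : tPOrderType d) : Prop :=
  forall A : set P, antichain A -> countable A.

(* Main.v *)
Require Import Defs.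
From HB Require Import structures.
From mathcomp Require Import all_boot all_order.
From mathcomp Require Import all_classical topology.

(** All seven statements are compared with the one about posets.

    From posets to spaces.  Let U be a non-empty open set lying in a
    quasiregular H-closed piece of a ccc space.  The non-empty open subsets of
    U, ordered by inclusion, form a ccc poset, because incompatible means
    disjoint.  For an open dense O the sets V whose closure lies in U and O are
    dense in this poset: this is quasiregularity.  A filter of the poset
    meeting these dense sets generates an open filter of the space; it
    clusters, by H-closedness, and a cluster point lies in every closure, hence
    in U and in every O ([poset_MA_generic_point]).  H-closedness gives
    cluster points because an open filter without any could be turned into a
    new point of a larger Hausdorff space, in which the old one would not be
    closed ([H_closed_cluster]).  Compact Hausdorff spaces are quasiregular and
    H-closed, so the statements about compactness are special cases.

    From compact spaces to posets ([compact_MA_poset]).  To a poset P is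
    attached the compact space [stone] of those truth assignments on P whose
    restriction to each finite part of P is settled by some element; it is
    the Stone space of the subalgebra generated by P in the complete Boolean
    algebra of P.  The clopen cones {y : y p} form a pi-base, so the ccc of P
    passes to the space, and a predense subset of P becomes a dense open set.
    A point y gives the set {p : y p} of pairwise compatible elements, which
    need not contain a lower bound of two of its members.  Asking for a lower
    bound of each pair of elements of P would take one dense set for every pair,
    and P may be larger than K.  By the ccc each dense set can be replaced by a
    predense sequence, so that only the elements in sequences already considered
    have to be looked at.  Closing off under this process leads to a family of
    sequences indexed by the trees [request K], and there are no more of these
    than elements of K because K * K injects into K ([square_injection]). *)

Set Implicit Arguments.
Unset Strict Implicit.
Unset Printing Implicit Defensive.

Local Open Scope classical_set_scope.
Local Open Scope card_scope.

(** * Squares of infinite types *)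

(** A maximal partial matching between A and B must exhaust one of the two
    sides. *)
Lemma injection_total (A B : Type) :
  (exists f : A -> B, injective f) \/ (exists g : B -> A, injective g).
Proof.
pose matching (R : set (A * B)) :=
  (forall a b b', R (a, b) -> R (a, b') -> b = b') /\
  (forall a a' b, R (a, b) -> R (a', b) -> a = a').
have [F FP Ftot|R [[Rfun Rinj] Rmax]] := @Zorn_bigcup (A * B)%type matching.
  have join p q : (\bigcup_(R in F) R) p -> (\bigcup_(R in F) R) q ->
      exists R, [/\ matching R, R p & R q].
    move=> [R FR Rp] [S FS Sq].
    have [RS|SR] := Ftot _ _ FR FS.
      by exists S; split=> //; [exact: FP|exact: RS].
    by exists R; split=> //; [exact: FP|exact: SR].
  split=> [a b b'|a a' b] p q; have [R [[R1 R2] Rp Rq]] := join _ _ p q.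
    exact: R1 Rp Rq.
  exact: R2 Rp Rq.
have [Rdom|/existsNP[a0 Ra0]] := pselect (forall a, exists b, R (a, b)).
  left; have [f Rf] := choice Rdom; exists f => a a' faa'.
  by apply: (Rinj _ _ (f a)) => //; rewrite faa'.
have [Rcod|/existsNP[b0 Rb0]] := pselect (forall b, exists a, R (a, b)).
  right; have [g Rg] := choice Rcod; exists g => b b' gbb'.
  by apply: (Rfun (g b)) => //; rewrite gbb'.
exfalso; apply: (Rmax (R `|` [set (a0, b0)])).
  split; first exact: subsetUl.
  by move=> /(_ (a0, b0)) R0; apply: Ra0; exists b0; apply: R0; right.
split=> [a b b'|a a' b] [Rp|p] [Rq|q].
- exact: Rfun Rp Rq.
- by case: q Rp => -> _ Rp; case: Ra0; exists b.
- by case: p Rq => -> _ Rq; case: Ra0; exists b'.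
- by case: p q => _ -> [_ ->].
- exact: Rinj Rp Rq.
- by case: q Rp => _ -> Rp; case: Rb0; exists a.
- by case: p Rq => _ -> Rq; case: Rb0; exists a'.
- by case: p q => -> _ [-> _].
Qed.

Section Square.
Context (K : Type) (i : nat -> K) (i_inj : injective i).

(** A pairing of a subset A of K, that is, an injection of A * A into A, is
    encoded by its graph, so that Zorn's lemma applies to inclusion of graphs.
    The subset A is recovered from the diagonal. *)
Definition dom (R : set (K * K * K)) : set K :=
  [set x | exists z, R (x, x, z)].

Definition pairing_on (R : set (K * K * K)) : Prop :=
  [/\ forall x y z, R (x, y, z) -> [/\ dom R x, dom R y & dom R z],
      forall x y, dom R x -> dom R y -> exists z, R (x, y, z),
      forall x y z z', R (x, y, z) -> R (x, y, z') -> z = z' &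
      forall x y x' y' z, R (x, y, z) -> R (x', y', z) -> x = x' /\ y = y'].

Definition nat_pairing : set (K * K * K) :=
  [set (i mn.1, i mn.2, i (pickle mn)) | mn in [set: nat * nat]].

Lemma dom_nat_pairing : dom nat_pairing = range i.
Proof.
apply/seteqP; split=> [x [z [[m n] _ [<- _ _]]]|_ [n _ <-]]; first by exists m.
by exists (i (pickle (n, n))), (n, n).
Qed.

Lemma nat_pairingP : pairing_on nat_pairing.
Proof.
split; rewrite ?dom_nat_pairing.
- by move=> _ _ _ [[m n] _ [<- <- <-]]; split; eexists.
- by move=> _ _ [m _ <-] [n _ <-]; exists (i (pickle (m, n))), (m, n).
- move=> x y z z' [[m n] _ [/= <- <- <-]] [[m' n'] _ [/= + + <-]].
  by move=> /i_inj -> /i_inj ->.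
- move=> x y x' y' z [[m n] _ [/= <- <- <-]] [[m' n'] _ [/= <- <- +]].
  by move=> /i_inj/(pcan_inj pickleK)[-> ->].
Qed.

Lemma pairing_on_bigcup (F : set (set (K * K * K))) :
  F `<=` pairing_on -> total_on F subset -> pairing_on (\bigcup_(R in F) R).
Proof.
move=> FP Ftot.
have join p q : (\bigcup_(R in F) R) p -> (\bigcup_(R in F) R) q ->
    exists R, [/\ F R, R p & R q].
  move=> [R FR Rp] [S FS Sq]; have [RS|SR] := Ftot _ _ FR FS.
    by exists S; split=> //; exact: RS.
  by exists R; split=> //; exact: SR.
have up R : F R -> dom R `<=` dom (\bigcup_(R in F) R).
  by move=> FR x [z Rz]; exists z, R.
split.
- move=> x y z [R FR Rxyz]; have [cl _ _ _] := FP _ FR.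
  by have [? ? ?] := cl _ _ _ Rxyz; split; apply: up FR _ _.
- move=> x y [z Fx] [w Fy]; have [R [FR Rx Ry]] := join _ _ Fx Fy.
  have [_ tot _ _] := FP _ FR.
  have [||v Rv] := tot x y; [by exists z|by exists w|by exists v, R].
- move=> x y z z' p q; have [R [FR Rp Rq]] := join _ _ p q.
  by have [_ _ fn _] := FP _ FR; exact: fn Rp Rq.
- move=> x y x' y' z p q; have [R [FR Rp Rq]] := join _ _ p q.
  by have [_ _ _ ij] := FP _ FR; exact: ij Rp Rq.
Qed.

Lemma pairing_onP (R : set (K * K * K)) : pairing_on R ->
  exists2 f : K -> K -> K,
    (forall x y, dom R x -> dom R y -> R (x, y, f x y)) &
    (forall x y x' y', dom R x -> dom R y -> dom R x' -> dom R y' ->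
      f x y = f x' y' -> x = x' /\ y = y').
Proof.
move=> [_ tot _ inj].
have /choice[f fP] : forall xy : K * K, exists z,
    dom R xy.1 -> dom R xy.2 -> R (xy.1, xy.2, z).
  move=> [x y] /=; have [[Rx Ry]|n] := pselect (dom R x /\ dom R y).
    by have [z] := tot _ _ Rx Ry; exists z.
  by exists x => ? ?; case: n.
exists (fun x y => f (x, y)) => [x y Rx Ry|x y x' y' Rx Ry Rx' Ry' E].
  exact: (fP (x, y)).
by apply: (inj _ _ _ _ (f (x, y))); [exact: (fP (x, y))|rewrite E; exact: (fP (x', y'))].
Qed.

(** If A is the domain of a pairing f and g injects A into its complement, then
    f extends to the union of A and g(A).  The pairs to be added fall into three
    classes, each a copy of A * A; a class is marked by an element of A, the
    pair is encoded by applying f twice, and g moves the result out of A. *)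
Lemma pairing_on_extend (R : set (K * K * K)) (g : K -> K) :
  pairing_on R -> range i `<=` dom R ->
  (forall x, dom R x -> ~ dom R (g x)) ->
  (forall x y, dom R x -> dom R y -> g x = g y -> x = y) ->
  exists2 S, pairing_on S & R `<` S.
Proof.
move=> RP iR gR g_inj; have [f fP f_inj] := pairing_onP RP.
have [cl _ fn ij] := RP.
have fR x y : dom R x -> dom R y -> dom R (f x y).
  by move=> Rx Ry; have [] := cl _ _ _ (fP _ _ Rx Ry).
have Ri n : dom R (i n) by exact: iR.
(* Every element of the union is e b x for a unique b and a unique x in A, and
   the pairs outside A * A are those of flags (b, c) with b || c. *)
pose e (b : bool) x := if b then g x else x.
pose v (b c : bool) x y := g (f (i (pickle (b, c))) (f x y)).
pose N : set (K * K * K) := [set p | exists b c x y,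
  [/\ b || c, dom R x, dom R y & p = (e b x, e c y, v b c x y)]].
have vR b c x y : dom R x -> dom R y -> ~ dom R (v b c x y).
  by move=> Rx Ry; apply/gR/fR => //; exact: fR.
have e_inj b c x y : dom R x -> dom R y -> e b x = e c y -> b = c /\ x = y.
  move=> Rx Ry; case: b c => -[] /= E; split=> //.
  - exact: g_inj.
  - by case: (gR _ Rx); rewrite E.
  - by case: (gR _ Rx); rewrite E.
  - by case: (gR _ Ry); rewrite -E.
  - by case: (gR _ Ry); rewrite -E.
have domS x : dom (R `|` N) x <-> exists b y, dom R y /\ x = e b y.
  split=> [[z [Rz|[b [c [y [y' [_ Ry _ [-> _ _]]]]]]]]|[b [y [Ry ->]]]].
  - by exists false, x; split=> //; exists z.
  - by exists b, y.
  - case: b => /=; last by case: Ry => z; exists z; left.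
    by exists (v true true y y); right; exists true, true, y, y.
exists (R `|` N); last first.
  split; first exact: subsetUl.
  move=> NR; apply: (gR (i 0)); first exact: Ri.
  exists (v true true (i 0) (i 0)); apply: NR.
  by right; exists true, true, (i 0), (i 0).
split.
- move=> x y z [/cl[Rx Ry Rz]|[b [c [x' [y' [bc Rx Ry [-> -> ->]]]]]]].
    by split; apply/domS; [exists false, x|exists false, y|exists false, z].
  split; apply/domS; [by exists b, x'|by exists c, y'|].
  exists true, (f (i (pickle (b, c))) (f x' y')); split=> //.
  by apply: (fR) => //; exact: fR.
- move=> _ _ /domS[b [x [Rx ->]]] /domS[c [y [Ry ->]]].
  have [bc|/norP[/negPf -> /negPf ->]] := boolP (b || c).
    by exists (v b c x y); right; exists b, c, x, y.
  by exists (f x y); left; exact: fP.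
(* A pair of R has both entries in A, so its flags are (false, false) and it is
   not among the new pairs. *)
- have mixed x y z : R (x, y, z) -> forall b c x' y', b || c ->
      dom R x' -> dom R y' -> x = e b x' -> y = e c y' -> False.
    move=> /cl[Rx Ry _] b c x' y' + Rx' Ry' E E'.
    have [<- _] := e_inj false b _ _ Rx Rx' E.
    by have [<- _] := e_inj false c _ _ Ry Ry' E'.
  move=> x y z z' [p|[b [c [u [w [bc Ru Rw [E1 E2 ->]]]]]]]
    [q|[b' [c' [u' [w' [bc' Ru' Rw' [E1' E2' ->]]]]]]].
  + exact: fn p q.
  + by case: (mixed _ _ _ p _ _ _ _ bc' Ru' Rw').
  + by case: (mixed _ _ _ q _ _ _ _ bc Ru Rw).
  + have [<- <-] := e_inj b b' _ _ Ru Ru' (etrans (esym E1) E1').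
    by have [<- <-] := e_inj c c' _ _ Rw Rw' (etrans (esym E2) E2').
- move=> x y x' y' z [p|[b [c [u [w [bc Ru Rw [-> -> E]]]]]]]
    [q|[b' [c' [u' [w' [bc' Ru' Rw' [-> -> E']]]]]]].
  + exact: ij p q.
  + by case: (vR b' c' u' w') => //; rewrite -E'; have [] := cl _ _ _ p.
  + by case: (vR b c u w) => //; rewrite -E; have [] := cl _ _ _ q.
  + have Rp d d' : dom R (i (pickle (d : bool, d' : bool))) by [].
    have Rf a a' : dom R a -> dom R a' -> dom R (f a a') by exact: fR.
    have := g_inj _ _ (fR _ _ (Rp b c) (Rf _ _ Ru Rw))
      (fR _ _ (Rp b' c') (Rf _ _ Ru' Rw')) (etrans (esym E) E').
    move=> /(f_inj _ _ _ _ (Rp b c) (Rf _ _ Ru Rw) (Rp b' c') (Rf _ _ Ru' Rw')).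
    move=> [/i_inj/(pcan_inj pickleK)[-> ->]].
    by move=> /(f_inj _ _ _ _ Ru Rw Ru' Rw')[-> ->].
Qed.

(** Hessenberg's theorem.  Let A be the domain of a maximal pairing.  The
    complement of A injects into A, since otherwise the pairing would extend;
    so K injects into two copies of A, hence into A by the pairing. *)
Lemma square_injection : exists p : K * K -> K, injective p.
Proof.
(* The empty graph, the union of the empty chain, has to be admitted; graphs
   containing the pairing of the naturals have an infinite domain. *)
pose good (R : set (K * K * K)) :=
  pairing_on R /\ (R !=set0 -> nat_pairing `<=` R).
have [F FP Ftot|R [[RP RN] Rmax]] := @Zorn_bigcup (K * K * K)%type good.
  split; first by apply: pairing_on_bigcup => // R /FP[].
  move=> [p [R FR Rp]]; apply: (@subset_trans _ R); last exact: bigcup_sup.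
  by have [_] := FP _ FR; apply; exists p.
have NR : nat_pairing `<=` R.
  apply: contrapT => nNR; have R0 : R = set0.
    by apply: contrapT => /eqP/set0P/RN.
  apply: (Rmax nat_pairing); last by split; [exact: nat_pairingP|move=> _].
  by rewrite R0 in nNR *; split.
have iR : range i `<=` dom R.
  by rewrite -dom_nat_pairing => x [z /NR]; exists z.
have Ri n : dom R (i n) by exact: iR.
have [f fP f_inj] := pairing_onP RP.
have [cl _ _ _] := RP.
have fR x y : dom R x -> dom R y -> dom R (f x y).
  by move=> Rx Ry; have [] := cl _ _ _ (fP _ _ Rx Ry).
have [[g g_inj]|[g g_inj]] :=
    injection_total {x | dom R x} {x | ~ dom R x}.
  pose h x := if pselect (dom R x) is left Rx then sval (g (exist _ x Rx)) else x.
  have [||S SP RS] := @pairing_on_extend R h RP iR.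
  - by move=> x Rx; rewrite /h; case: pselect => // Rx'; exact: (svalP (g _)).
  - move=> x y Rx Ry; rewrite /h; case: pselect => // Rx'; case: pselect => // Ry'.
    by move=> /eq_sig_hprop E; have [] := g_inj _ _ (E (fun _ _ _ => Prop_irrelevance _ _)).
  exfalso; apply: (Rmax _ RS); split=> // _.
  by apply: (subset_trans NR); exact: properW.
pose h x := if pselect (dom R x) is right Rx
  then f (i 1) (sval (g (exist _ x Rx))) else f (i 0) x.
have hR x : dom R (h x).
  rewrite /h; case: pselect => [Rx|nRx]; apply: fR => //.
  exact: (svalP (g _)).
have h_inj : injective h.
  move=> x y; rewrite /h; case: pselect => [Rx|nRx]; case: pselect => [Ry|nRy].
  - by move=> /f_inj[].
  - by move=> /f_inj[] //; [exact: (svalP (g _))|move=> /i_inj].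
  - by move=> /f_inj[] //; [exact: (svalP (g _))|move=> /i_inj].
  - move=> /f_inj[] //; [exact: (svalP (g _))..|].
    by move=> _ /eq_sig_hprop E; have [] := g_inj _ _ (E (fun _ _ _ => Prop_irrelevance _ _)).
exists (fun xy => f (h xy.1) (h xy.2)) => -[x y] [x' y'] /=.
by move=> /f_inj[] // /h_inj -> /h_inj ->.
Qed.

End Square.

Lemma nat_injection (K : Type) :
  [set: nat] #<= [set: K] -> exists i : nat -> K, injective i.
Proof.
move=> /card_leP[i].
exists (fun n => set_val (i (exist _ n (mem_set I)))) => m n /val_inj.
by move=> /('inj_i (mem_set I) (mem_set I)) [].
Qed.

Lemma injection_retraction (A B : Type) (f : A -> B) (a0 : A) :
  injective f -> exists g : B -> A, cancel f g.
Proof.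
move=> f_inj; have /choice[g gP] : forall b, exists a, (exists a', f a' = b) -> f a = b.
  move=> b; have [[a fa]|nb] := pselect (exists a, f a = b); last by exists a0.
  by exists a.
by exists g => a; apply: f_inj; apply: gP; exists a.
Qed.

(** Indices of predense sequences: [Given k] stands for the k-th dense set, and
    [Merge s m t n] for the task of finding a lower bound of the m-th term of
    sequence s and the n-th term of sequence t. *)
Inductive request (K : Type) : Type :=
| Given of K
| Merge of request K & nat & request K & nat.

Lemma request_injection (K : Type) (i : nat -> K) : injective i ->
  exists code : request K -> K, injective code.
Proof.
move=> i_inj; have [p p_inj] := square_injection i_inj.
pose fix code (s : request K) : K :=
  match s with
  | Given k => p (i 0, k)
  | Merge s m t n => p (i 1, p (p (code s, i m), p (code t, i n)))
  end.
exists code; elim=> [k|s IHs m t IHt n] [k'|s' m' t' n'] //= /p_inj[].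
- by move=> ->.
- by move=> /i_inj.
- by move=> /i_inj.
- by move=> /p_inj[/p_inj[/IHs -> /i_inj ->] /p_inj[/IHt -> /i_inj ->]].
Qed.

(** * The Stone space of a poset *)

Section Stone.
Context {d : Order.disp_t} {P : tPOrderType d}.
Local Open Scope order_scope.
Import Order.POrderTheory.

Lemma compatible_self (p : P) : compatible p p.
Proof. by exists p. Qed.

Lemma compatible_sym (p q : P) : compatible p q -> compatible q p.
Proof. by move=> [r [rp rq]]; exists r. Qed.

(** A maximal antichain among the elements of D is predense, and it is
    countable by the ccc. *)
Lemma dense_predense_sequence (D : set P) : ccc_poset P -> poset_dense D ->
  exists2 e : nat -> P, (forall n, D (e n)) & forall p, exists n, compatible p (e n).
Proof.
move=> Pccc Ddense.
have [F FP Ftot|A [[AD Aanti] Amax]] :=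
    @Zorn_bigcup P [set A | A `<=` D /\ antichain A].
  split; first by apply: bigcup_sub => A /FP[].
  move=> p q [A FA Ap] [B FB Bq].
  by have [AB|BA] := Ftot _ _ FA FB; [have [_] := FP _ FB|have [_] := FP _ FA];
    apply => //; [exact: AB|exact: BA].
have Apre p : exists2 a, A a & compatible p a.
  apply: contrapT => nA; have [q Dq qp] := Ddense p.
  have qA a : A a -> ~ compatible q a.
    by move=> Aa [r [rq ra]]; apply: nA; exists a => //; exists r; split=> //;
      exact: le_trans qp.
  have nAq : ~ A q by move=> /qA; apply; exact: compatible_self.
  apply: (Amax (A `|` [set q])).
    by split; [exact: subsetUl|move=> /(_ q) Aq; apply/nAq/Aq; right].
  split; first by move=> a [/AD//|->].
  move=> a b [Aa|->] [Ab|->] //.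
  - exact: Aanti.
  - by move=> _ /compatible_sym; exact: qA.
  - by move=> _; exact: qA.
have [a0 Aa0 _] := Apre \top.
have /pfcard_geP[A0|[f]] : A #<= [set: nat] by exact: Pccc.
  by rewrite A0 in Aa0.
exists f => [n|p]; first by apply: AD; exact: funS.
have [a Aa pa] := Apre p; have [n _ fn] := 'surj_f Aa.
by exists n; rewrite fn.
Qed.

Definition decided (y : P -> bool) (l : seq P) : Prop :=
  exists r, forall q, q \in l -> if y q then is_true (r <= q) else ~ compatible r q.

(** The closure in {0,1}^P of the set of ultrafilters of P.  A closed condition
    on finite parts describes it, and this makes it compact. *)
Definition stone : Type := {y : P -> bool | forall l, decided y l}.

HB.instance Definition _ := gen_eqMixin stone.
HB.instance Definition _ := gen_choiceMixin stone.

Definition agree (y : stone) (l : seq P) : set stone :=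
  [set z | forall q, q \in l -> sval z q = sval y q].

(** The topology is the trace of the product topology on {0,1}^P. *)
Definition stone_nbhs (y : stone) : set_system stone :=
  filter_from [set: seq P] (agree y).

Lemma stone_nbhs_filter (y : stone) : ProperFilter (stone_nbhs y).
Proof.
apply: filter_from_proper; last by move=> l _; exists y.
apply: filter_from_filter; first by exists nil.
move=> k l _ _; exists (k ++ l) => // z zy.
by split=> q ql; apply: zy; rewrite mem_cat ql ?orbT.
Qed.

Lemma stone_nbhs_singleton (y : stone) (A : set stone) : stone_nbhs y A -> A y.
Proof. by move=> [l _]; apply. Qed.

Lemma stone_nbhs_nbhs (y : stone) (A : set stone) :
  stone_nbhs y A -> stone_nbhs y (stone_nbhs^~ A).
Proof.
move=> [l _ lA]; exists l => // z zy; exists l => // w wz; apply: lA => q ql.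
by rewrite wz// zy.
Qed.

HB.instance Definition _ := hasNbhs.Build stone stone_nbhs.
HB.instance Definition _ := Nbhs_isNbhsTopological.Build stone
  stone_nbhs_filter stone_nbhs_singleton stone_nbhs_nbhs.

Lemma filter_all_seq (T : Type) (F : set_system T) (A : P -> set T) (l : seq P) :
  Filter F -> (forall q, q \in l -> F (A q)) -> F [set t | forall q, q \in l -> A q t].
Proof.
move=> FF; elim: l => [|p l IHl] FA; first exact: filterS filterT.
have Fp : F (A p) by apply: FA; exact: mem_head.
have Fl : F [set t | forall q, q \in l -> A q t].
  by apply: IHl => q ql; apply: FA; rewrite in_cons ql orbT.
apply: filterS (filterI Fp Fl) => t [Ap Al] q.
by rewrite in_cons => /predU1P[->//|]; exact: Al.
Qed.

Definition cone (p : P) : set stone := [set y : stone | sval y p].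

Lemma cone_open (p : P) : open (cone p).
Proof. by rewrite openE => y yp; exists [:: p] => // z zy; rewrite /cone /= zy ?mem_head. Qed.

Lemma cone_compatible (p q : P) (y : stone) : cone p y -> cone q y -> compatible p q.
Proof.
move=> yp yq; have [r rl] := svalP y [:: p; q]; exists r.
have := rl p; have := rl q; rewrite !inE !eqxx orbT yp yq.
by move=> /(_ isT) rq /(_ isT).
Qed.

Lemma cone_le (p q : P) : p <= q -> cone p `<=` cone q.
Proof.
move=> pq y yp; apply: contrapT => yq; have [r rl] := svalP y [:: p; q].
have := rl p; have := rl q; rewrite !inE !eqxx orbT yp (negPf (introN idP yq)).
move=> /(_ isT) rq /(_ isT) rp; apply: rq; exists r; split=> //.
exact: le_trans pq.
Qed.

(** The sets containing all elements below densely many elements below p form a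
    filter on P.  For an ultrafilter F extending it and for each q, either the
    elements below q or those incompatible with q form a member of F; an
    element settling a given finite list is picked from the intersection of the
    members that its entries provide. *)
Lemma cone_nonempty (p : P) : cone p !=set0.
Proof.
pose eventually_below : set_system P :=
  [set S | forall q, q <= p -> exists2 r, r <= q & forall s, s <= r -> S s].
have below_proper : ProperFilter eventually_below.
  apply: Build_ProperFilter_ex.
    by move=> S /(_ p (lexx p))[r _ Sr]; exists r; exact: Sr.
  split; first by move=> q _; exists q.
    move=> S T Sb Tb q qp; have [r rq Sr] := Sb _ qp.
    have [t tr Tt] := Tb _ (le_trans rq qp); exists t; first exact: le_trans rq.
    by move=> s st; split; [exact: Sr (le_trans st tr)|exact: Tt].
  move=> S T ST Sb q /Sb[r rq Sr]; exists r => // s /Sr; exact: ST.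
have [F [FU pF]] := ultraFilterLemma below_proper.
pose y q := `[< F [set s | s <= q] >].
have yP l : decided y l.
  have /filter_ex[r rP] : F [set r | forall q, q \in l ->
      if y q then is_true (r <= q) else ~ compatible r q].
    apply: filter_all_seq => q _.
    rewrite /y; case: asboolP => // nF.
    have [//|Fc] := in_ultra_setVsetC [set s | s <= q] FU.
    have Fq : F [set s | s <= q \/ ~ compatible s q].
      apply: pF => t tp; have [[r [rt rq]]|ntq] := pselect (compatible t q).
        by exists r => // s sr; left; exact: le_trans rq.
      exists t => // s st; right=> -[u [us uq]]; apply: ntq; exists u; split=> //.
      exact: le_trans st.
    by apply: filterS (filterI Fq Fc) => s [[]].
  by exists r.
exists (exist _ y yP); apply/asboolP/pF => q qp; exists q => // s sq.
exact: le_trans qp.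
Qed.

(** Cones form a pi-base: an r that settles the finite list defining a
    neighbourhood forces every point of its cone to agree on this list. *)
Lemma cone_base (y : stone) (U : set stone) : nbhs y U -> exists p, cone p `<=` U.
Proof.
move=> [l _ lU]; have [r rl] := svalP y l; exists r => z zr; apply: lU => q /rl.
case: (sval y q) => rq; first exact: cone_le rq _ zr.
by apply: contra_notF rq => zq; exact: cone_compatible zr zq.
Qed.

Lemma stone_hausdorff : hausdorff_space stone.
Proof.
move=> y z yz; apply: eq_sig_hprop => [?|]; first exact: Prop_irrelevance.
apply/funext => q.
have [||w [wy wz]] := yz (agree y [:: q]) (agree z [:: q]).
- by exists [:: q].
- by exists [:: q].
by rewrite -wy ?mem_head// wz ?mem_head.
Qed.

(** An ultrafilter converges to its pointwise limit, which is again a point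
    because it agrees with some point on each finite list. *)
Lemma stone_compact : compact [set: stone].
Proof.
rewrite compact_ultra => F FU _.
pose y q := `[< F (cone q) >].
have Fy (l : seq P) : F [set z : stone | forall q, q \in l -> sval z q = y q].
  apply: (@filter_all_seq _ F (fun q => [set z : stone | sval z q = y q])).
  move=> q _; rewrite /y.
  case: asboolP => [Fq|nF]; first by apply: filterS Fq.
  have [//|Fc] := in_ultra_setVsetC (cone q) FU.
  by apply: filterS Fc => z /negP/negPf.
have yP l : decided y l.
  have /filter_ex[z zy] := Fy l; have [r rl] := svalP z l.
  by exists r => q ql; rewrite -zy//; exact: rl.
exists (exist _ y yP); split=> // A [l _ lA].
by apply: filterS (Fy l) => z zy; exact: lA.
Qed.

(** Choosing a cone inside each member of a disjoint family gives pairwise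
    incompatible elements. *)
Lemma stone_ccc : ccc_poset P -> ccc_space stone.
Proof.
move=> Pccc F Fopen Fdisj.
have /choice[r rP] : forall U : set stone, exists p, F U -> cone p `<=` U.
  move=> U; have [FU|nFU] := pselect (F U); last by exists \top.
  have [Uo [y Uy]] := Fopen _ FU.
  by have [|p pU] := @cone_base y U; [exact: open_nbhs_nbhs|exists p].
have meet U V p : F U -> F V -> p <= r U -> p <= r V -> U = V.
  move=> FU FV pU pV; apply: Fdisj => //; have [y yp] := cone_nonempty p.
  by exists y; split; [apply: (rP U) => //; exact: cone_le pU _ yp|
    apply: (rP V) => //; exact: cone_le pV _ yp].
have rinj : {in F &, injective r}.
  move=> U V /set_mem FU /set_mem FV rUV.
  by apply: (meet _ _ (r U)) => //; rewrite -rUV.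
rewrite -(eq_countable (inj_card_eq rinj)); apply: Pccc.
move=> _ _ [U FU <-] [V FV <-] rUV [p [pU pV]]; apply: rUV; congr r.
exact: meet pU pV.
Qed.

Lemma bigcup_cone_dense (e : nat -> P) :
  (forall p, exists n, compatible p (e n)) -> dense (\bigcup_n cone (e n)).
Proof.
move=> epre U [y Uy] Uo; have [|p pU] := @cone_base y U.
  exact: open_nbhs_nbhs.
have [n [q [qp qn]]] := epre p; have [z zq] := cone_nonempty q.
exists z; split; first by apply: pU; exact: cone_le qp _ zq.
by exists n => //; exact: cone_le qn _ zq.
Qed.

End Stone.

(** * Filters from compact spaces *)

Definition compact_MA (K : Type) : Prop :=
  forall X : topologicalType,
    hausdorff_space X -> [set: X] !=set0 -> compact [set: X] ->
    ccc_space X ->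
    forall U : K -> set X, (forall a, open (U a) /\ dense (U a)) ->
    \bigcap_a U a !=set0.

Definition poset_MA (K : Type) : Prop :=
  forall (d : Order.disp_t) (P : tPOrderType d),
    ccc_poset P ->
    forall Ds : set (set P),
    (forall D, Ds D -> poset_dense D) -> Ds #<= [set: K] ->
    exists2 G : set P, poset_filter G &
      forall D, Ds D -> D `&` G !=set0.

Section Poset.
Context {d : Order.disp_t} {P : tPOrderType d}.
Local Open Scope order_scope.
Import Order.POrderTheory.

(** Membership of r in this set, together with compatibility of r with p and
    with q, makes r a common lower bound. *)
Lemma merge_dense (p q : P) : poset_dense
  [set r | r <= p /\ r <= q \/ ~ compatible r p \/ ~ compatible r q].
Proof.
move=> s; have [[t [ts tp]]|nsp] := pselect (compatible s p); last first.
  by exists s => //; right; left.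
have [[u [ut uq]]|ntq] := pselect (compatible t q); last first.
  by exists t => //; right; right.
exists u; last exact: le_trans ts.
by left; split=> //; exact: le_trans tp.
Qed.

(** The closing-off: every pair of elements that occur in the sequences has its
    own sequence of candidates for a lower bound. *)
Lemma predense_closure (K : Type) (D : K -> set P) :
  ccc_poset P -> (forall k, poset_dense (D k)) ->
  exists e : request K -> nat -> P,
    [/\ forall s p, exists n, compatible p (e s n),
        forall k n, D k (e (Given k) n) &
        forall s m t n l (p := e s m) (q := e t n) (r := e (Merge s m t n) l),
          r <= p /\ r <= q \/ ~ compatible r p \/ ~ compatible r q].
Proof.
move=> Pccc Ddense.
have /choice[c cP] : forall k, exists c : nat -> P,
    (forall n, D k (c n)) /\ forall p, exists n, compatible p (c n).
  move=> k; have [c cD cpre] := dense_predense_sequence Pccc (Ddense k).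
  by exists c.
have /choice[s sP] : forall pq : P * P, exists s : nat -> P,
    (forall n, s n <= pq.1 /\ s n <= pq.2 \/
       ~ compatible (s n) pq.1 \/ ~ compatible (s n) pq.2) /\
    forall p, exists n, compatible p (s n).
  move=> [p q]; have [s sD spre] := dense_predense_sequence Pccc (merge_dense p q).
  by exists s.
pose fix e (r : request K) : nat -> P :=
  match r with
  | Given k => c k
  | Merge r m t n => s (e r m, e t n)
  end.
exists e; split=> [[k|r m t n] p|k n|r m t n l].
- by have [_] := cP k; exact.
- by have [_] := sP (e r m, e t n); exact.
- by have [cD _] := cP k; exact: cD.
- by have [+ _] := sP (e r m, e t n); exact.
Qed.

(** If y meets every sequence, the elements of the sequences that y accepts are
    directed: those accepted by y are pairwise compatible, so the accepted
    candidate for a lower bound of two of them is one. *)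
Lemma stone_point_filter (K : Type) (e : request K -> nat -> P) (y : @stone d P) :
  inhabited K ->
  (forall s m t n l (p := e s m) (q := e t n) (r := e (Merge s m t n) l),
     r <= p /\ r <= q \/ ~ compatible r p \/ ~ compatible r q) ->
  (forall s, exists n, cone (e s n) y) ->
  poset_filter [set p | exists s n, cone (e s n) y /\ e s n <= p].
Proof.
move=> [k0] esplit ye; split.
- by have [n yn] := ye (Given k0); exists (Given k0), n; split=> //; exact: lex1.
- move=> p q [s [m [ym emp]]] [t [n [yn enq]]].
  have [l yl] := ye (Merge s m t n).
  have [[rm rn]|[nc|nc]] := esplit s m t n l.
  + exists (e (Merge s m t n) l); split; [|exact: le_trans emp|exact: le_trans enq].
    by exists (Merge s m t n), l.
  + by case: nc; exact: cone_compatible yl ym.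
  + by case: nc; exact: cone_compatible yl yn.
- by move=> p q [s [n [yn ep]]] pq; exists s, n; split=> //; exact: le_trans pq.
Qed.

End Poset.

(** One open dense set of [stone] for each request: the union of the cones over
    its sequence. *)
Lemma compact_MA_poset (K : Type) : [set: nat] #<= [set: K] ->
  compact_MA K -> poset_MA K.
Proof.
move=> Kinf MA d P Pccc Ds Dsdense DsK.
have [g gP] := elimT pcard_surjP DsK.
have [i i_inj] := nat_injection Kinf.
have [|e [epre eD esplit]] := @predense_closure d P K
    (fun k => [set p | Ds (g k) -> g k p]) Pccc _.
  move=> k p; have [Dk|nDk] := pselect (Ds (g k)); last by exists p.
  by have [q Dq qp] := Dsdense _ Dk p; exists q.
(* Requests are at most as many as the elements of K, so the open dense sets
   can be listed along K. *)
have [code code_inj] := request_injection i_inj.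
have [decode codeK] := injection_retraction (Given (i 0)) code_inj.
have [|k|y yU] := MA (@stone d P) stone_hausdorff _ stone_compact
    (stone_ccc Pccc) (fun k => \bigcup_n cone (e (decode k) n)).
- by have [y _] := @cone_nonempty d P Order.top; exists y.
- split; last by apply: bigcup_cone_dense; exact: epre.
  by apply: bigcup_open => n _; exact: cone_open.
have ye s : exists n, cone (e s n) y.
  by have [n _ yn] := yU (code s) I; exists n; rewrite codeK in yn.
exists [set p | exists s n, cone (e s n) y /\ (e s n <= p)%O].
  exact: (stone_point_filter (inhabits (i 0)) esplit ye).
move=> D DD; have [k _ gk] := gP D DD; have [n yn] := ye (Given k).
exists (e (Given k) n); split; last by exists (Given k), n.
by have := eD k n; rewrite /= gk; exact.
Qed.

(** * H-closed spaces and open filters *)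

Record openFilter (X : topologicalType) := OpenFilter {
  openFilter_sys :> set_system X;
  #[global] openFilter_proper :: ProperFilter openFilter_sys;
  openFilter_interior : forall A, openFilter_sys A -> openFilter_sys A°
}.

(** X with one more point, whose neighbourhoods trace the members of F on X.
    Openness of the filter is what makes this a topology. *)
Definition adjoin_limit (X : topologicalType) (F : openFilter X) : Type := option X.

Section AdjoinLimit.
Context {X : topologicalType} (F : openFilter X).
Local Notation Y := (adjoin_limit F).

HB.instance Definition _ := Choice.on Y.

Definition adjoin_nbhs (y : Y) : set_system Y :=
  if y is Some x then [set A | nbhs x (Some @^-1` A)]
  else [set A | A None /\ openFilter_sys F (Some @^-1` A)].

Lemma adjoin_nbhs_filter (y : Y) : ProperFilter (adjoin_nbhs y).
Proof.
case: y => [x|] /=; first exact: fmap_proper_filter (nbhs_pfilter x).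
apply: Build_ProperFilter_ex; first by move=> A [AN _]; exists None.
split=> [|A B [AN FA] [BN FB]|A B AB [AN FA]].
- by split=> //; exact: filterT.
- by split=> //; exact: filterI.
- by split; [exact: AB|apply: filterS FA => x; exact: AB].
Qed.

Lemma adjoin_nbhs_singleton (y : Y) (A : set Y) : adjoin_nbhs y A -> A y.
Proof. by case: y => [x /nbhs_singleton|[]]. Qed.

Lemma adjoin_nbhs_nbhs (y : Y) (A : set Y) :
  adjoin_nbhs y A -> adjoin_nbhs y (adjoin_nbhs^~ A).
Proof.
case: y => [x xA|[AN FA]]; first exact: nbhs_interior.
by split; [split|exact: openFilter_interior].
Qed.

HB.instance Definition _ := hasNbhs.Build Y adjoin_nbhs.
HB.instance Definition _ := Nbhs_isNbhsTopological.Build Y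
  adjoin_nbhs_filter adjoin_nbhs_singleton adjoin_nbhs_nbhs.

Lemma adjoin_embedding : embedding (Some : X -> Y).
Proof.
split=> [x y []//|x A //|U Uo].
exists (Some @` U : set Y).
  rewrite openE => _ [x Ux <-]; rewrite /interior /=.
  apply: filterS (open_nbhs_nbhs (conj Uo Ux)) => z Uz; by exists z.
by apply/seteqP; split=> [_ [x Ux <-]|_ [[x Ux <-] _]]; [split; exists x|exists x].
Qed.

(** The new point is separated from x exactly when x is not a cluster point
    of F. *)
Lemma adjoin_hausdorff :
  hausdorff_space X -> cluster F = set0 -> hausdorff_space Y.
Proof.
move=> XT2 F0.
have sep x : ~ cluster (nbhs (None : Y)) (Some x).
  move=> xN; suff: cluster F x by rewrite F0.
  move=> A B FA xB; have [||y [yA yB]] := xN (Some @` A `|` [set None]) (Some @` B).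
  - split; first by right.
    by apply: filterS FA => z Az; left; exists z.
  - by apply: filterS xB => z Bz; exists z.
  case: yB yA => z Bz <- [[w Aw [wz]]|//].
  by exists z; split=> //; rewrite -wz.
have sepC x : ~ cluster (nbhs (Some x : Y)) None.
  move=> Nx; apply: (sep x) => A B NA xB.
  by rewrite setIC; exact: Nx.
move=> [x|] [y|] // xy; [|by case: (sepC x)|by case: (sep y)].
congr Some; apply: XT2 => A B xA yB.
have [||z] := xy (Some @` A) (Some @` B).
- by apply: filterS xA => z Az; exists z.
- by apply: filterS yB => z Bz; exists z.
by move=> [[w Aw <-] [v Bv [vw]]]; exists w; split=> //; rewrite -vw.
Qed.

(** Otherwise the space extended by the limit of F would be a Hausdorff space
    in which X, being dense and proper, is not closed. *)
Lemma H_closed_cluster : H_closed X -> cluster F !=set0.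
Proof.
move=> [XT2 Xclosed]; apply/set0P/negP => /eqP F0.
have /(_ None) := Xclosed _ _ (adjoin_hausdorff XT2 F0) adjoin_embedding.
case=> [A [_ FA]|x _ //].
by have [x Ax] := filter_ex FA; exists (Some x); split=> //; exists x.
Qed.

End AdjoinLimit.

(** * The poset of non-empty open subsets of an open set *)

Definition nonempty_open (X : topologicalType) : Type :=
  {U : set X | open U /\ U !=set0}.

Definition opens_below (X : topologicalType) (U : nonempty_open X) : Type :=
  {V : nonempty_open X | sval V `<=` sval U}.

Section OpensBelow.
Context {X : topologicalType} (U : nonempty_open X).
Local Notation P := (opens_below U).

HB.instance Definition _ := gen_eqMixin P.
HB.instance Definition _ := gen_choiceMixin P.

Definition carrier (V : P) : set X := sval (sval V).

Definition opens_le (V W : P) : bool := `[< carrier V `<=` carrier W >].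

Lemma opens_le_refl : reflexive opens_le.
Proof. by move=> V; exact/asboolP. Qed.

Lemma opens_le_anti : antisymmetric opens_le.
Proof.
move=> V W /andP[/asboolP VW /asboolP WV].
apply: eq_sig_hprop => [?|]; first exact: Prop_irrelevance.
apply: eq_sig_hprop => [?|]; first exact: Prop_irrelevance.
exact/seteqP.
Qed.

Lemma opens_le_trans : transitive opens_le.
Proof.
by move=> W V T /asboolP VW /asboolP WT; apply/asboolP; exact: subset_trans WT.
Qed.

Lemma opens_le_top (V : P) : opens_le V (exist _ U (@subset_refl _ (sval U))).
Proof. by apply/asboolP; exact: (svalP V). Qed.

HB.instance Definition _ := Order.Le_isPOrder.Build (Order.Disp tt tt) P
  opens_le_refl opens_le_anti opens_le_trans.
HB.instance Definition _ := Order.hasTop.Build (Order.Disp tt tt) P opens_le_top.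

End OpensBelow.

Section BelowTheory.
Context {X : topologicalType} (U : nonempty_open X).
Local Notation P := (opens_below U).

Lemma carrier_open (V : P) : open (carrier V).
Proof. by have [] := svalP (sval V). Qed.

Lemma carrier_nonempty (V : P) : carrier V !=set0.
Proof. by have [] := svalP (sval V). Qed.

Lemma carrier_sub (V : P) : carrier V `<=` sval U.
Proof. exact: (svalP V). Qed.

Lemma carrierP (W : set X) : open W -> W !=set0 -> W `<=` sval U ->
  exists V : P, carrier V = W.
Proof. by move=> Wo W0 WU; exists (exist _ (exist _ W (conj Wo W0)) WU). Qed.

Lemma carrier_le (V W : P) : (V <= W)%O <-> carrier V `<=` carrier W.
Proof. by split=> [/asboolP|VW]; [|exact/asboolP]. Qed.

(** Open sets that meet are compatible in the poset, their intersection being a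
    lower bound; so antichains are disjoint families. *)
Lemma opens_below_ccc : ccc_space X -> ccc_poset P.
Proof.
move=> Xccc A Aanti.
have carrier_inj : injective (@carrier X U).
  by move=> V W VW; apply: Order.POrderTheory.le_anti; apply/andP;
    split; apply/carrier_le; rewrite VW.
have carrier_injA : {in A &, injective (@carrier X U)} by move=> V W _ _ /carrier_inj.
rewrite -(eq_countable (inj_card_eq carrier_injA)); apply: Xccc.
  by move=> _ [V _ <-]; split; [exact: carrier_open|exact: carrier_nonempty].
move=> _ _ [V AV <-] [W AW <-] VW; congr carrier.
apply: contrapT => /(Aanti _ _ AV AW); apply.
have [||T TVW] := @carrierP (carrier V `&` carrier W) _ VW.
- by apply: openI; exact: carrier_open.
- by move=> x [Vx _]; exact: carrier_sub Vx.
by exists T; split; apply/carrier_le; rewrite TVW => x [].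
Qed.

End BelowTheory.

(** * Generic points from filters *)

Section Generic.
Context {X : topologicalType}.

(** This and [clustering_below] are what quasiregularity and H-closedness of a
    piece of the space containing U say about U in terms of the topology of the
    whole space. *)
Definition quasiregular_below (U : set X) : Prop :=
  forall V : set X, open V -> V !=set0 -> V `<=` U ->
    exists W : set X, [/\ open W, W !=set0 & closure W `<=` V].

Definition clustering_below (U : set X) : Prop :=
  forall F : openFilter X, openFilter_sys F U -> cluster F !=set0.

Lemma filter_openFilter (U : nonempty_open X) (G : set (opens_below U)) :
  poset_filter G -> exists F : openFilter X,
    openFilter_sys F (sval U) /\ forall V, G V -> openFilter_sys F (carrier V).
Proof.
move=> [G1 Gmeet _].
have proper : ProperFilter (filter_from G (@carrier X U)).
  apply: filter_from_proper; last by move=> V _; exact: carrier_nonempty.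
  apply: filter_from_filter; first by exists \top%O.
  move=> V W GV GW; have [T [GT /carrier_le TV /carrier_le TW]] := Gmeet _ _ GV GW.
  by exists T => // x Tx; split; [exact: TV|exact: TW].
have interiorP A : filter_from G (@carrier X U) A -> filter_from G (@carrier X U) A°.
  by move=> [V GV VA]; exists V => //; rewrite -open_subsetE//; exact: carrier_open.
exists (OpenFilter proper interiorP); split.
  by exists \top%O => //; exact: carrier_sub.
by move=> V GV; exists V.
Qed.

(** The open filter generated by a filter of open sets that meets the dense
    sets D a has a cluster point, and this lies in all the closures, so in U and
    in each O a. *)
Lemma poset_MA_generic_point (K : Type) (U : set X) (O : K -> set X) :
  inhabited K -> poset_MA K -> ccc_space X -> open U -> U !=set0 ->
  quasiregular_below U -> clustering_below U ->
  (forall a, open (O a) /\ dense (O a)) ->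
  (U `&` \bigcap_a O a) !=set0.
Proof.
move=> [k0] MA Xccc Uo U0 Uqr Ucl OP.
pose u : nonempty_open X := exist _ U (conj Uo U0).
pose D a := [set V : opens_below u | closure (carrier V) `<=` U `&` O a].
have Ddense a : poset_dense (D a).
  move=> V; have [Oo Od] := OP a.
  have [|||W [Wo W0 WV]] := Uqr (carrier V `&` O a).
  - by apply: openI => //; exact: carrier_open.
  - by apply: Od; [exact: carrier_nonempty|exact: carrier_open].
  - by move=> x [Vx _]; exact: carrier_sub Vx.
  have [|w wW] := @carrierP X u W Wo W0.
    by move=> x /subset_closure/WV[Vx _]; exact: carrier_sub Vx.
  exists w.
    by rewrite /D /= wW => x /WV[Vx Ox]; split=> //; exact: carrier_sub Vx.
  by apply/carrier_le; rewrite wW => x /subset_closure/WV[].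
have [||G Gfilter Gmeet] := MA _ _ (opens_below_ccc Xccc) (range D).
- by move=> _ [a _ <-].
- exact: card_image_le.
have [F [FU FG]] := filter_openFilter Gfilter.
have [x xF] := Ucl F FU.
have xUO a : (U `&` O a) x.
  have [|V [VD /FG FV]] := Gmeet (D a); first by exists a.
  by apply: VD; move: xF; rewrite clusterE; apply.
by exists x; split=> [|a _]; [have [] := xUO k0|have [] := xUO a].
Qed.

End Generic.

Lemma quasiregular_belowT (X : topologicalType) (U : set X) :
  quasiregular X -> quasiregular_below U.
Proof. by move=> Xqr V Vo V0 _; exact: Xqr. Qed.

Lemma H_closed_clustering (X : topologicalType) (U : set X) :
  H_closed X -> clustering_below U.
Proof. by move=> XH F _; exact: H_closed_cluster. Qed.

(** * Subspaces *)

Section Subspace.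
Context {X : topologicalType} (A : set X).

Lemma subspace_embedding : embedding (set_val : A -> X).
Proof.
split=> [x y /val_inj//||U [V Vo <-]]; first exact: initial_continuous.
exists V => //; apply/seteqP; split=> [y [x Vx xy]|y [Vy [x _ xy]]].
  by rewrite -xy; split=> //; exists x.
by exists x => //; rewrite /preimage /= xy.
Qed.

Lemma image_val_preimage (B : set X) :
  B `<=` A -> set_val @` (set_val @^-1` B : set A) = B.
Proof.
move=> BA; apply/seteqP; split=> [_ [x Bx <-]//|x Bx].
by exists (exist _ x (mem_set (BA x Bx))).
Qed.

Lemma H_closed_subspace_closed : hausdorff_space X -> H_closed A -> closed A.
Proof.
move=> XT2 [_ Acl].
have <- : range (set_val : A -> X) = A; last exact: Acl XT2 subspace_embedding.
apply/seteqP; split=> [_ [x _ <-]|x Ax]; first exact: set_valP.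
by exists (exist _ x (mem_set Ax)).
Qed.

(** An open subset W of the subspace A inside V is of the form T `&` V with T
    open in X, since V is open in X and contained in A; as A is closed, the
    closure of W is the same in A and in X. *)
Lemma quasiregular_subspace_below (U : set X) :
  closed A -> quasiregular A -> open U -> U `<=` A -> quasiregular_below U.
Proof.
move=> Acl Aqr Uo UA V Vo [x Vx] VU.
have VA : V `<=` A by exact: subset_trans UA.
have [||W [[T To TW] [w Ww] WV]] := Aqr (set_val @^-1` V).
- by exists V.
- by exists (exist _ x (mem_set (VA x Vx))).
have WV' : T `&` A `<=` V.
  move=> y [Ty Ay]; apply: (WV (exist _ y (mem_set Ay))).
  by apply: subset_closure; rewrite -TW.
have TAV : T `&` V = T `&` A.
  by apply/seteqP; split=> y [Ty Py]; split=> //; [exact: VA|exact: WV'].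
exists (T `&` V); split; first exact: openI.
  by exists (set_val w); rewrite TAV; split; [rewrite -TW in Ww|exact: set_valP].
move=> y Ty; have Ay : A y.
  by apply: Acl; apply: closureS Ty => z [_ /VA].
apply: (WV (exist _ y (mem_set Ay))) => N [B [[C Co CB] By BN]].
have [|z [[Tz Vz] Cz]] := Ty C.
  by apply: open_nbhs_nbhs; split=> //; rewrite -CB in By.
exists (exist _ z (mem_set (VA z Vz))); split; first by rewrite -TW.
by apply: BN; rewrite -CB.
Qed.

(** The trace on A of an open filter containing A is an open filter of A; its
    cluster points in A are cluster points in X. *)
Lemma H_closed_subspace_clustering (U : set X) :
  H_closed A -> U `<=` A -> clustering_below U.
Proof.
move=> AH UA F FU.
have FA : openFilter_sys F A by apply: filterS FU.
pose FA_sys : set_system A := [set S | openFilter_sys F (set_val @` S)].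
have proper : ProperFilter FA_sys.
  apply: Build_ProperFilter_ex.
    move=> S FS; have [_ [x Sx _]] := filter_ex (FS : openFilter_sys F _).
    by exists x.
  split.
  - by apply: filterS FA => x Ax; exists (exist _ x (mem_set Ax)).
  - move=> S T; rewrite /FA_sys /= => FS FT; apply: filterS (filterI FS FT) => _ [[x Sx <-] [y Ty]].
    by move=> /val_inj yx; exists x => //; split=> //; rewrite -yx.
  - move=> S T ST; rewrite /FA_sys /= => FS.
    by apply: filterS FS => _ [x Sx <-]; exists x => //; exact: ST.
have interiorP S : FA_sys S -> FA_sys S°.
  rewrite /FA_sys /= => FS.
  apply: filterS (filterI FA (openFilter_interior FS)) => x [Ax Sx].
  exists (exist _ x (mem_set Ax)) => //.
  exists (set_val @^-1` (set_val @` S)°); split=> //.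
    by exists (set_val @` S)° => //; exact: open_interior.
  by move=> z /interior_subset[w Sw /val_inj <-].
have [a aF] := @H_closed_cluster _ (OpenFilter proper interiorP) AH.
exists (set_val a) => B C FB aC.
have [||b [Bb Cb]] := aF (set_val @^-1` B) (set_val @^-1` C).
- by apply: filterS (filterI FA FB) => x [Ax Bx]; exists (exist _ x (mem_set Ax)).
- exact: initial_continuous.
by exists (set_val b).
Qed.

Lemma compact_subspace : compact A -> compact [set: A].
Proof.
move=> Aco F FF _.
have [|x [Ax xF]] := Aco (set_val @ F) (fmap_proper_filter _ FF).
  by apply: (@filterS _ F _ setT); [move=> y _; exact: set_valP|exact: filterT].
exists (exist _ x (mem_set Ax)); split=> // B N FB [V [[C Co CV] Vx VN]].
have [||y [[z Bz zy] Cy]] := xF (set_val @` B) C.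
- by apply: (@filterS _ F _ B) => // z Bz; exists z.
- by apply: open_nbhs_nbhs; split=> //; rewrite -CV in Vx.
by exists z; split=> //; apply: VN; rewrite -CV /preimage /= zy.
Qed.

End Subspace.

(** * Compact Hausdorff spaces *)

Lemma compact_quasiregular (X : topologicalType) :
  hausdorff_space X -> compact [set: X] -> quasiregular X.
Proof.
move=> XT2 Xco U Uo [x Ux].
have [V xV VU] := compact_regular XT2 Xco filterT (open_nbhs_nbhs (conj Uo Ux)).
exists V°; split; first exact: open_interior.
  by exists x.
exact: (subset_trans (closureS (@interior_subset _ V)) VU).
Qed.

Lemma compact_H_closed (X : topologicalType) :
  hausdorff_space X -> compact [set: X] -> H_closed X.
Proof.
move=> XT2 Xco; split=> // Y f YT2 [_ fcont _]; apply: compact_closed => //.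
by apply: continuous_compact => //; exact: continuous_subspaceT.
Qed.

Lemma hausdorff_subspace (X : topologicalType) (A : set X) :
  hausdorff_space X -> hausdorff_space A.
Proof.
move=> XT2 x y xy; apply: val_inj; apply: XT2 => B C xB yC.
have [||z [Bz Cz]] := xy (set_val @^-1` B) (set_val @^-1` C).
- exact: initial_continuous.
- exact: initial_continuous.
by exists (set_val z).
Qed.

Lemma compact_subspace_qHc (X : topologicalType) (A : set X) :
  hausdorff_space X -> compact A -> quasiregular A /\ H_closed A.
Proof.
move=> XT2 /compact_subspace Aco; have AT2 := @hausdorff_subspace _ A XT2.
by split; [exact: compact_quasiregular|exact: compact_H_closed].
Qed.

(** * The equivalences *)

Definition generic_point (K : Type) (X : topologicalType) : Prop :=
  forall U : K -> set X, (forall a, open (U a) /\ dense (U a)) ->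
  \bigcap_a U a !=set0.

Definition generic_dense (K : Type) (X : topologicalType) : Prop :=
  forall U : K -> set X, (forall a, open (U a) /\ dense (U a)) ->
  dense (\bigcap_a U a).

Lemma generic_dense_point (K : Type) (X : topologicalType) :
  [set: X] !=set0 -> generic_dense K X -> generic_point K X.
Proof.
move=> X0 XK U /XK /(_ _ X0 openT)[x [_ Ux]]; by exists x.
Qed.

Section FromPosets.
Context (K : Type) (K0 : inhabited K) (MA : poset_MA K).
Context {X : topologicalType} (XT2 : hausdorff_space X) (Xccc : ccc_space X).

(** Density of an intersection is checked on small open sets, so it is enough
    that each open set contains one that lies in a quasiregular H-closed
    subspace. *)
Lemma generic_dense_of_qHc_pieces :
  (forall O : set X, open O -> O !=set0 -> exists U A : set X,
    [/\ open U, U !=set0, U `<=` O `&` A & quasiregular A /\ H_closed A]) ->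
  generic_dense K X.
Proof.
move=> pieces O OP W W0 Wo.
have [U [A [Uo U0 UWA [Aqr AH]]]] := pieces W Wo W0.
have UA : U `<=` A by move=> x /UWA[].
have [||x [/UWA[Wx _] Ox]] := poset_MA_generic_point K0 MA Xccc Uo U0 _ _ OP.
- exact: quasiregular_subspace_below (H_closed_subspace_closed XT2 AH) Aqr Uo UA.
- exact: H_closed_subspace_clustering AH UA.
by exists x.
Qed.

Lemma generic_dense_qHc_nbhs :
  dense [set x : X | has_qHc_nbhs x] -> generic_dense K X.
Proof.
move=> Xd; apply: generic_dense_of_qHc_pieces => O Oo O0.
have [x [Ox [A xA Aq]]] := Xd O O0 Oo; exists (O `&` A°), A; split=> //.
- by apply: openI => //; exact: open_interior.
- by exists x.
- by move=> y [Oy /interior_subset].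
Qed.

Lemma generic_dense_qHc_pi_base :
  (exists B : set (set X), qHc_pi_base B) -> generic_dense K X.
Proof.
move=> [B [[Bo Bsub] Bq]]; apply: generic_dense_of_qHc_pieces => O Oo O0.
have [U BU UO] := Bsub O Oo O0; exists U, (closure U).
have [Uo U0] := Bo U BU; split=> //; last exact: Bq.
by move=> x Ux; split; [exact: UO|exact: subset_closure].
Qed.

Lemma generic_point_qHc :
  [set: X] !=set0 -> quasiregular X -> H_closed X -> generic_point K X.
Proof.
move=> X0 Xqr XH O OP.
have [||x [_ Ox]] := poset_MA_generic_point K0 MA Xccc openT X0 _ _ OP.
- exact: quasiregular_belowT.
- exact: H_closed_clustering.
by exists x.
Qed.

End FromPosets.

Lemma compact_nbhs_qHc (X : topologicalType) : hausdorff_space X ->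
  [set x : X | has_compact_nbhs x] `<=` [set x | has_qHc_nbhs x].
Proof.
by move=> XT2 x [N xN Nco]; exists N => //; exact: compact_subspace_qHc.
Qed.

Lemma compact_pi_base_qHc (X : topologicalType) (B : set (set X)) :
  hausdorff_space X -> compact_pi_base B -> qHc_pi_base B.
Proof.
by move=> XT2 [Bpi Bco]; split=> // U /Bco; exact: compact_subspace_qHc.
Qed.

Lemma compact_space_compact_nbhs (X : topologicalType) :
  compact [set: X] -> dense [set x : X | has_compact_nbhs x].
Proof.
move=> Xco U [x Ux] _; exists x; split=> //.
by exists [set: X] => //; exact: filterT.
Qed.

Lemma compact_space_pi_base (X : topologicalType) :
  compact [set: X] -> compact_pi_base [set U : set X | open U /\ U !=set0].
Proof.
move=> Xco; split; first by split=> // U Uo U0; exists U.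
by move=> U _; apply: subclosed_compact Xco _ => //; exact: closed_closure.
Qed.

Theorem theorem4p3 (K : Type)
  (K_infinite : [set: nat] #<= [set: K])
  (K_lt_continuum : [set: K] #<= [set: set nat] /\
                    [set: K] #!= [set: set nat]) :
  [<->
    (* (1) *)
    (forall X : topologicalType,
       hausdorff_space X -> [set: X] !=set0 -> compact [set: X] ->
       ccc_space X ->
       forall U : K -> set X, (forall a, open (U a) /\ dense (U a)) ->
       \bigcap_a U a !=set0);
    (* (2) *)
    (forall X : topologicalType,
       hausdorff_space X -> ccc_space X ->
       dense [set x : X | has_compact_nbhs x] ->
       forall U : K -> set X, (forall a, open (U a) /\ dense (U a)) ->
       dense (\bigcap_a U a));
    (* (3) *)
    (forall (d : Order.disp_t) (P : tPOrderType d),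
       ccc_poset P ->
       forall Ds : set (set P),
       (forall D, Ds D -> poset_dense D) -> Ds #<= [set: K] ->
       exists2 G : set P, poset_filter G &
         forall D, Ds D -> D `&` G !=set0);
    (* (4) *)
    (forall X : topologicalType,
       hausdorff_space X -> [set: X] !=set0 ->
       quasiregular X -> H_closed X -> ccc_space X ->
       forall U : K -> set X, (forall a, open (U a) /\ dense (U a)) ->
       \bigcap_a U a !=set0);
    (* (5) *)
    (forall X : topologicalType,
       hausdorff_space X -> ccc_space X ->
       dense [set x : X | has_qHc_nbhs x] ->
       forall U : K -> set X, (forall a, open (U a) /\ dense (U a)) ->
       dense (\bigcap_a U a));
    (* (6) *)
    (forall X : topologicalType,
       hausdorff_space X -> ccc_space X ->
       (exists B : set (set X), compact_pi_base B) ->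
       forall U : K -> set X, (forall a, open (U a) /\ dense (U a)) ->
       dense (\bigcap_a U a));
    (* (7) *)
    (forall X : topologicalType,
       hausdorff_space X -> ccc_space X ->
       (exists B : set (set X), qHc_pi_base B) ->
       forall U : K -> set X, (forall a, open (U a) /\ dense (U a)) ->
       dense (\bigcap_a U a)) ].
Proof.
have K0 : inhabited K.
  have [i _] := nat_injection K_infinite; exact: inhabits (i 0).
tfae.
- move=> /(compact_MA_poset K_infinite) MA X XT2 Xccc Xd.
  apply: (generic_dense_qHc_nbhs K0 MA) => // U U0 Uo.
  by have [x [Ux /(compact_nbhs_qHc XT2)]] := Xd U U0 Uo; exists x.
- move=> MA2; apply: compact_MA_poset => // X XT2 X0 Xco Xccc.
  apply: generic_dense_point X0 _; apply: MA2 => //.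
  exact: compact_space_compact_nbhs.
- by move=> MA X XT2 X0 Xqr XH Xccc; exact: (generic_point_qHc K0 MA).
- move=> MA4 X XT2 Xccc; apply: generic_dense_qHc_nbhs => //.
  apply: compact_MA_poset => // Y YT2 Y0 Yco Yccc; apply: MA4 => //.
    exact: compact_quasiregular.
  exact: compact_H_closed.
- move=> MA5 X XT2 Xccc [B /(compact_pi_base_qHc XT2) Bq].
  apply: generic_dense_qHc_pi_base => //; last by exists B.
  apply: compact_MA_poset => // Y YT2 Y0 Yco Yccc.
  apply: generic_dense_point Y0 _; apply: MA5 => // U U0 Uo.
  have [y [Uy /(compact_nbhs_qHc YT2)]] := compact_space_compact_nbhs Yco U0 Uo.
  by exists y.
- move=> MA6 X XT2 Xccc; apply: generic_dense_qHc_pi_base => //.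
  apply: compact_MA_poset => // Y YT2 Y0 Yco Yccc.
  apply: generic_dense_point Y0 _; apply: MA6 => //.
  by eexists; exact: compact_space_pi_base.
- move=> MA7 X XT2 X0 Xco Xccc; apply: generic_dense_point X0 _; apply: MA7 => //.
  by eexists; apply: compact_pi_base_qHc => //; exact: compact_space_pi_base.
Qed.
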